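(* Fix integers $k\ge3$ and a prime $p>k$. Suppose $x^k-1=g_1(x)\cdots g_\ell(x)$ with each $g_i$ irreducible over $\mathbb{F}_p$. Let $m$ be a positive integer less than $\ell$, let $1\le i_1<\dots<i_m\le\ell$, and suppose $g_{i_j}(x)=x-1$ for some $j$. Let $d=\sum_{j=1}^m\deg(g_{i_j}(x))$. Then there exists a $k$-gon $[a_0,\dots,a_{k-1}]$ modulo $p$ whose monodromy group is isomorphic to $C_p^{k-d}\rtimes C_k$.
   Context: A $k$-tuple of positive integers $[a_0,\dots,a_{k-1}]$ ($k\ge3$) is a (geometric) $k$-gon modulo $n$ if $\sum a_i=(k-2)n$, $a_i<2n$, $a_i\ne n$ for all $i$, and $\gcd(a_0,\dots,a_{k-1},n)=1$. Its monodromy group is $N\rtimes C_k$, where $N\subseteq(\mathbb{Z}/n\mathbb{Z})^k$ is the additive subgroup generated by the columns of the circulant matrix $C$ with $(i,j)$ entry $a_{(i-j)\bmod k}$, and $C_k$ acts on $N$ by cyclic permutation of coordinates (this coincides with the monodromy group of the dessin on the polygon's rational billiards surface, generated by $\sigma_0(m,i)=(m,i+1)$, $\sigma_1(m,i)=(m-a_{i-1},i-1)$ on $\mathbb{Z}/n\mathbb{Z}\times\mathbb{Z}/k\mathbb{Z}$). $C_m$ denotes the cyclic group of order $m$. *)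

(* Defs.v *)
From mathcomp Require Import all_boot all_fingroup all_algebra cyclic.

Set Implicit Arguments.
Unset Strict Implicit.
Unset Printing Implicit Defensive.

Import GRing.Theory.
Local Open Scope ring_scope.

(* A tuple satisfying this forces n >= 2, so 'Z_n below is then really Z/nZ. *)
Definition is_polygon (k n : nat) (a : k.-tuple nat) : Prop :=
  [/\ (3 <= k)%N,
      forall i : 'I_k, [/\ (0 < tnth a i)%N, (tnth a i < 2 * n)%N
                         & tnth a i <> n],
      (\sum_(i < k) tnth a i)%N = ((k - 2) * n)%N
    & gcdn (\big[gcdn/0%N]_(i < k) tnth a i) n = 1%N].

(* i + (k - j) represents i - j mod k without truncated subtraction. *)
Definition circulant (k n : nat) (a : k.-tuple nat) : 'M['Z_n]_k :=
  \matrix_(i < k, j < k) (nth 0%N a ((i + (k - j)) %% k))%:R.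

Definition circ_group (k n : nat) (a : k.-tuple nat) :
    {group 'cV['Z_n]_k} :=
  <<[set col j (circulant n a) | j : 'I_k]>>%G.

Definition rot_perm (k : nat) : 'S_k := perm (@ordS_inj k).

Lemma iter_ordS (k s : nat) (i : 'I_k) :
  iter s (@ordS k) i = ((i + s) %% k)%N :> nat.
Proof.
elim: s => [|s IHs] /=; first by rewrite addn0 modn_small.
by rewrite IHs -addn1 modnDml addn1 addnS.
Qed.

Lemma rot_permX (k s : nat) (i : 'I_k) :
  (rot_perm k ^+ s)%g i = ((i + s) %% k)%N :> nat.
Proof.
rewrite permX -iter_ordS; congr nat_of_ord.
by apply: eq_iter => j; rewrite permE.
Qed.

Lemma order_rot_perm (k : nat) : (0 < k)%N -> #[rot_perm k]%g = k.
Proof.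
move=> k_gt0; apply/eqP; rewrite eqn_dvd; apply/andP; split.
  rewrite order_dvdn; apply/eqP/permP=> i; apply: val_inj.
  by rewrite /= rot_permX perm1 modnDr modn_small.
have /permP/(_ (Ordinal k_gt0))/(congr1 val) := expg_order (rot_perm k).
by rewrite /= rot_permX perm1 /= add0n => /eqP.
Qed.

(* The inverse makes this a right action, (v . s) (s i) = v i, so that
   rot_perm moves the coordinate in position i to position i + 1 mod k. *)
Definition coord_act (k n : nat) (v : 'cV['Z_n]_k) (s : 'S_k) : 'cV['Z_n]_k :=
  row_perm s^-1%g v.

Lemma coord_is_action (k n : nat) :
  is_action [set: 'S_k] (@coord_act k n).
Proof.
apply: is_total_action => [v | v s t]; first by rewrite /coord_act invg1 row_perm1.
by rewrite /coord_act invMg row_permM.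
Qed.

Canonical coord_action (k n : nat) := Action (@coord_is_action k n).

Lemma coord_is_groupAction (k n : nat) :
  is_groupAction [set: 'cV['Z_n]_k] (coord_action k n).
Proof.
move=> s _; rewrite /= inE; apply/andP; split; first by apply/subsetP=> v; rewrite inE.
apply/morphicP=> v w _ _; rewrite !actpermE.
by apply/matrixP=> i j; rewrite !mxE.
Qed.

Canonical coord_groupAction (k n : nat) :=
  GroupAction (@coord_is_groupAction k n).

Lemma coord_act_circ (k n : nat) (a : k.-tuple nat) (j : 'I_k) :
  coord_act (col j (circulant n a)) (rot_perm k)
  = col (ordS j) (circulant n a).
Proof.
have k_gt0 : (0 < k)%N by apply: leq_ltn_trans (ltn_ord j).
have idxE x y : (y < k)%N -> (x + (k - y) + y = x %[mod k])%N.
  by move=> lt_yk; rewrite -addnA subnK ?modnDr // ltnW.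
apply/matrixP=> i z; rewrite !mxE; congr (nth 0%N a _)%:R.
pose i' := (rot_perm k)^-1%g i; rewrite -/i'.
have -> : i = ordS i' by rewrite -[LHS](permKV (rot_perm k)) permE.
apply/eqP; rewrite -(eqn_modDr (ordS j)) idxE //.
by rewrite /= modnDmr addnS -addn1 -modnDml idxE // modnDml addn1 modn_mod.
Qed.

Lemma circ_group_acts (k n : nat) (a : k.-tuple nat) :
  {acts <[rot_perm k]>%g, on group circ_group n a | coord_groupAction k n}.
Proof.
split; last exact: subsetT.
apply: acts_gen; first exact: subsetT.
rewrite cycle_subG 2!inE in_setT; apply/subsetP=> _ /imsetP[j _ ->].
rewrite inE; apply/imsetP; exists (ordS j) => //.
exact: coord_act_circ.
Qed.

(* circ_group n a ><| C_k as an external semidirect product, C_k being realised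
   as the cyclic group <[rot_perm k]> of order k (order_rot_perm). *)
Definition monodromy (k n : nat) (a : k.-tuple nat) : finGroupType :=
  sdprod_by <[circ_group_acts n a]>%gact.

(* Main.v *)
(** Only the order of the module N matters: N is elementary abelian, so once
    |N| = p^(k-d) it is isomorphic to F_p^(k-d), and the semidirect product is
    transported along this isomorphism.  Identify a tuple with the polynomial
    A = sum a_i x^i; then N is the ideal generated by A in F_p[x]/(x^k - 1), of
    dimension k - deg gcd(A, x^k - 1).

    So one needs A of degree < k with A(1) = 0, with a gcd of degree d, and with
    all k coefficients nonzero.  Such an A (or -A) lifts to a polygon: its
    residues in (0, p) have sum s p with 1 <= s <= k - 2, and adding p to
    k - 2 - s of them gives the required sum.

    Let T be the set of factors that must not divide A.  For a single factor
    g_i, a multiple of (x^k - 1)/g_i with nonzero coefficients exists because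
    k < p hyperplanes do not cover a space over F_p.  In general, add to such a
    multiple c times (x^k - 1)/prod_{j in T, j <> i} g_j.  If the latter product
    has degree at least 2, the coefficient of x^(k-1) does not change, so c has
    to avoid at most k < p values.  The only remaining case is T consisting of
    two linear factors, where c must avoid k + 1 values.  For k = p - 1 this can
    really fail (e.g. T = {x - 2, x - 4} over F_5), but the conclusion depends
    on d only, so T may be replaced by {x - 2, x + 2}, for which
    A = (x + 1)(x^k - 1)/(x^2 - 4) works. *)

Require Import Defs.
From mathcomp Require Import all_boot all_fingroup all_algebra.
From mathcomp Require Import all_solvable all_field all_character.
From mathcomp Require Import zify ring.

Set Implicit Arguments.
Unset Strict Implicit.
Unset Printing Implicit Defensive.

Import GRing.Theory.
Local Open Scope ring_scope.

(** * Transport of a semidirect product along isomorphisms of both factors *)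

Section SdprodTransport.
Local Open Scope group_scope.

Variables (aT rT aT' rT' : finGroupType) (D : {group aT}) (R : {group rT}).
Variable to : groupAction D R.
Variables (f : {morphism R >-> rT'}) (h : {morphism [set: aT'] >-> aT}).
Hypotheses (injf : 'injm f) (imf : f @* R = [set: rT']).
Hypotheses (injh : 'injm h) (imh : h @* [set: aT'] = D).

Definition transported_act (x : rT') (b : aT') : rT' :=
  f (to (invm injf x) (h b)).

Let h_in b : h b \in D.
Proof. by rewrite -imh mem_morphim ?inE. Qed.

Let invf_in x : invm injf x \in R.
Proof.
have : x \in f @* R by rewrite imf inE.
by case/morphimP=> y Ry _ ->; rewrite invmE.
Qed.

Let fK x : f (invm injf x) = x.
Proof. by rewrite invmK // imf inE. Qed.

Lemma transported_is_action : is_action [set: aT'] transported_act.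
Proof.
apply: is_total_action => [x | x b c]; rewrite /transported_act.
  by rewrite morph1 act1 fK.
by rewrite morphM ?inE // actMin // invmE // gact_stable.
Qed.

Canonical transported_action := Action transported_is_action.

Lemma transported_is_groupAction :
  is_groupAction [set: rT'] transported_action.
Proof.
move=> b _; rewrite /= inE; apply/andP; split.
  by apply/subsetP=> x; rewrite inE.
apply/morphicP=> x y _ _; rewrite !actpermE /= /transported_act.
rewrite (morphM (invm_morphism injf)) ?imf ?inE // gactM ?invf_in ?h_in //.
by rewrite (morphM f) ?gact_stable ?invf_in ?h_in.
Qed.

Canonical transported_groupAction := GroupAction transported_is_groupAction.

Lemma transported_sdprod_isog :
  (* The isomorphism is built from the transported product to the original one: [invm injf] and [h],
     followed by the canonical embeddings of the original product, respect the actions and glue to a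
     bijective morphism. *)
  [set: sdprod_by to] \isog [set: sdprod_by transported_groupAction].
Proof.
rewrite isog_sym; apply/isogP.
have dom1 : [set: rT'] \subset 'dom (sdpair1 to \o invm injf).
  apply/subsetP=> x _; apply/morphpreP; split; last exact: invf_in.
  by rewrite /= imf inE.
have dom2 : [set: aT'] \subset 'dom (sdpair2 to \o h).
  by apply/subsetP=> b _; rewrite !inE; apply: h_in.
pose f1 := [morphism of restrm dom1 (sdpair1 to \o invm injf)].
pose f2 := [morphism of restrm dom2 (sdpair2 to \o h)].
have act12 : {in [set: rT'] & [set: aT'],
    morph_act transported_groupAction 'J f1 f2}.
  move=> x b _ _ /=; rewrite /restrm /= /transported_act invmE ?gact_stable //.
  exact: sdpair_act.
have im1 : f1 @* [set: rT'] = sdpair1 to @* R.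
  rewrite morphim_restrm setIid morphim_comp; congr (_ @* _).
  by rewrite -imf morphim_invm.
have im2 : f2 @* [set: aT'] = sdpair2 to @* D.
  by rewrite morphim_restrm setIid morphim_comp imh.
exists (xsdprod_morphism act12); last by rewrite im_xsdprodm im1 im2 im_sdpair.
rewrite injm_xsdprodm im1 im2 im_sdpair_TI eqxx andbT; apply/andP; split.
  by rewrite injm_restrm // injm_comp ?injm_sdpair1 ?injm_invm.
by rewrite injm_restrm // injm_comp ?injm_sdpair2.
Qed.

End SdprodTransport.

Lemma mx_Zp_abelem (p m n : nat) :
  prime p -> (p.-abelem [set: 'M['Z_p]_(m, n)])%g.
Proof.
by move=> p_pr; have := mx_Fp_abelem m n p_pr; rewrite (pdiv_id p_pr).
Qed.

(** Elementary abelian groups of equal order are isomorphic, and so are cyclic ones. The action on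
    the row vectors is whatever the two chosen isomorphisms transport. *)
Lemma monodromy_isog (k p r : nat) (a : k.-tuple nat) :
  (1 < k)%N -> prime p -> #|circ_group p a| = (p ^ r)%N ->
  exists to : groupAction [set: 'Z_k] [set: 'rV['Z_p]_r],
    [set: monodromy p a] \isog [set: sdprod_by to].
Proof.
move=> k_gt1 p_pr cardN.
have abN : (p.-abelem (circ_group p a))%g.
  exact: abelemS (subsetT _) (mx_Zp_abelem k 1 p_pr).
have : circ_group p a \isog [set: 'rV['Z_p]_r].
  rewrite (isog_abelem_card _ abN) mx_Zp_abelem // cardN cardsT card_mx mul1n.
  by rewrite card_ord Zp_cast ?eqxx ?prime_gt1.
case/isogP=> f injf imf.
have : [set: 'Z_k] \isog <[rot_perm k]>%g.
  have cycZ : cyclic [set: 'Z_k] by apply/cyclicP; exists Zp1; exact: Zp_cycle.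
  rewrite isog_cyclic_card // cycle_cyclic cardsT card_ord Zp_cast //.
  by rewrite -orderE order_rot_perm ?eqxx ?(ltnW k_gt1).
case/isogP=> h injh imh.
exists (transported_groupAction (<[circ_group_acts p a]>%gact) injf imf imh).
exact: transported_sdprod_isog.
Qed.

(** * The order of the circulant module *)

(* Represents 'X * u modulo 'X^k - 1 when size u <= k. *)
Definition cyc_shift (F : fieldType) (k : nat) (u : {poly F}) : {poly F} :=
  'X * u - u`_k.-1 *: ('X^k - 1).

Lemma coef_cyc_shift (F : fieldType) (k : nat) (u : {poly F}) (i : nat) :
  (0 < k)%N -> (size u <= k)%N ->
  (cyc_shift k u)`_i =
    if (i < k)%N then u`_(if i is j.+1 then j else k.-1) else 0.
Proof.
case: k => // k _ szu; rewrite !(coefB, coefZ, coefXM, coefXn, coef1) /=.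
case: i => [|i]; first by rewrite /= sub0r sub0r mulrN1 opprK.
rewrite !eqSS subr0 ltnS; case: (ltngtP i k) => [||->] /=.
- by rewrite mulr0 subr0.
- by move=> lt_ki; rewrite nth_default ?mulr0 ?subr0 //; apply: leq_trans szu _.
- by rewrite mulr1 subrr.
Qed.

Lemma size_cyc_shift (F : fieldType) (k : nat) (u : {poly F}) :
  (0 < k)%N -> (size u <= k)%N -> (size (cyc_shift k u) <= k)%N.
Proof.
move=> k_gt0 szu; apply/leq_sizeP => i le_ki.
by rewrite coef_cyc_shift // ltnNge le_ki.
Qed.

Lemma dvdp_cyc_shift (F : fieldType) (k : nat) (w u : {poly F}) :
  w %| 'X^k - 1 -> w %| u -> w %| cyc_shift k u.
Proof. by move=> wP wu; rewrite dvdp_sub -?mul_polyC ?dvdp_mull. Qed.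

Section CirculantCard.

Variables (k p : nat) (a : k.-tuple nat).
Hypotheses (k_gt0 : (0 < k)%N) (p_pr : prime p).

Let P : {poly 'F_p} := 'X^k - 1.
Let A : {poly 'F_p} := \poly_(i < k) (nth 0%N a i)%:R.
(* 'F_p is 'Z_(pdiv p): the modulus pdiv p makes the entries live in a field. *)
Let N := circ_group (pdiv p) a.
Let G := gcdp A P.
Let r := (k - (size G).-1)%N.

Definition coef_col (u : {poly 'F_p}) : 'cV['F_p]_k := \col_i u`_i.

Definition circ_col (j : nat) : {poly 'F_p} :=
  \poly_(i < k) (nth 0%N a ((i + (k - j)) %% k))%:R.

Lemma coef_col_inj (u v : {poly 'F_p}) :
  (size u <= k)%N -> (size v <= k)%N -> coef_col u = coef_col v -> u = v.
Proof.
move=> szu szv eq_uv; apply/polyP=> i; case: (ltnP i k) => [lt_ik | le_ki].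
  by have /colP/(_ (Ordinal lt_ik)) := eq_uv; rewrite !mxE.
by rewrite !nth_default // (leq_trans _ le_ki).
Qed.

Let sizeP : size P = k.+1.
Proof. by rewrite size_XnsubC. Qed.

Lemma modp_Xn_sub_1_small (u : {poly 'F_p}) : (size u <= k)%N -> u %% P = u.
Proof. by move=> szu; rewrite modp_small // sizeP. Qed.

(** Column [j.+1] is the cyclic shift of column [j], so each step of the induction multiplies by
    ['X] modulo [P]. *)
Lemma circ_colE (j : nat) : (j <= k)%N -> circ_col j = ('X^j * A) %% P.
Proof.
elim: j => [_ | j IHj lt_jk].
  rewrite mul1r modp_Xn_sub_1_small ?size_poly //.
  apply/polyP=> i; rewrite !coef_poly; case: ifP => // lt_ik.
  by rewrite subn0 modnDr modn_small.
rewrite exprS -mulrA -modp_mul -IHj 1?ltnW //.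
have sz : (size (circ_col j) <= k)%N by exact: size_poly.
have -> : circ_col j.+1 = cyc_shift k (circ_col j).
  apply/polyP=> i; rewrite coef_cyc_shift // !coef_poly; case: ifP => // lt_ik.
  case: i lt_ik => [|i] lt_ik; last first.
    by rewrite (ltnW lt_ik); congr (nth _ _ _)%:R; congr (_ %% _)%N; lia.
  rewrite prednK // leqnn; congr (nth _ _ _)%:R.
  (* The wrap-around coefficient: the index read at position [k.-1] of column [j] exceeds the one at
     position 0 of column [j.+1] by exactly [k]. *)
  have -> : (k.-1 + (k - j) = (0 + (k - j.+1)) + k)%N by lia.
  by rewrite modnDr.
rewrite -[LHS]modp_Xn_sub_1_small ?size_cyc_shift // /cyc_shift.
by rewrite modpD modpN modpZl modpp scaler0 oppr0 addr0.
Qed.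

Lemma col_circulant (j : 'I_k) :
  col j (circulant (pdiv p) a) = coef_col (circ_col j).
Proof. by apply/colP=> i; rewrite !mxE coef_poly ltn_ord. Qed.

(** Scalars of a prime field are images of naturals, so an additive subgroup is already a
    subspace. *)
Lemma circ_groupZ (c : 'F_p) (v : 'cV['F_p]_k) : v \in N -> c *: v \in N.
Proof. by move=> Nv; rewrite -[c]natr_Zp scaler_nat; apply: groupX. Qed.

(** By linearity it suffices to treat monomials of degree below [k], whose products with [A] are the
    columns. *)
Lemma coef_col_mulr_circ (B : {poly 'F_p}) : coef_col ((B * A) %% P) \in N.
Proof.
rewrite mulrC -modp_mul [A * _]mulrC; set B' := B %% P.
have szB : (size B' <= k)%N.
  by rewrite -ltnS -sizeP ltn_modp -size_poly_gt0 sizeP.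
rewrite -[B'](coefK) poly_def; move: B' szB => B' szB.
apply: (big_ind (fun B => coef_col ((B * A) %% P) \in N)).
- rewrite mul0r mod0p.
  have -> : coef_col 0 = 0 by apply/colP=> i; rewrite !mxE coef0.
  exact: group1.
- move=> u v Nu Nv.
  have -> : coef_col (((u + v) * A) %% P) =
            coef_col ((u * A) %% P) + coef_col ((v * A) %% P).
    by apply/colP=> i; rewrite !mxE mulrDl modpD coefD.
  exact: groupM.
move=> j _.
have lt_jk : (j < k)%N by apply: leq_trans szB.
have -> : coef_col ((B'`_j *: 'X^j * A) %% P) =
          B'`_j *: coef_col (circ_col (Ordinal lt_jk)).
  apply/colP=> i; rewrite !mxE -scalerAl modpZl coefZ circ_colE //; exact: ltnW.
apply: circ_groupZ; rewrite -col_circulant; apply: mem_gen; exact: imset_f.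
Qed.

Let G_neq0 : G != 0.
Proof. by rewrite gcdp_eq0 negb_and -[P == 0]size_poly_eq0 sizeP orbT. Qed.

Let sizeG : ((size G).-1 <= k)%N.
Proof.
have := dvdp_leq _ (dvdp_gcdr A P); rewrite -size_poly_gt0 sizeP => /(_ isT).
by rewrite -/G; lia.
Qed.

Let size_mulG (b : {poly 'F_p}) : (size b <= r)%N -> (size (b * G)%R <= k)%N.
Proof.
move=> szb; apply: leq_trans (size_polyMleq _ _) _.
move: szb sizeG G_neq0; rewrite /r -size_poly_gt0.
by move: (size G) (size b) => s t; lia.
Qed.

(** Modulo [P], the ideals generated by [A] and by [G] coincide. Encoding the cofactor of [G] as a
    row vector of length [r] prepares the count. *)
Lemma circ_groupE :
  N = [set coef_col (rVpoly b * G) | b : 'rV['F_p]_r] :> {set 'cV['F_p]_k}.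
Proof.
set S := [set _ | _ : _].
have grS : group_set S.
  apply/group_setP; split.
    apply/imsetP; exists 0 => //; apply/colP=> i.
    by rewrite !mxE linear0 mul0r coef0.
  move=> _ _ /imsetP[b _ ->] /imsetP[c _ ->].
  apply/imsetP; exists (b + c) => //; apply/colP=> i.
  by rewrite !mxE linearD mulrDl coefD.
apply/eqP; rewrite eqEsubset; apply/andP; split.
  (* Reduction modulo [P] preserves divisibility by [G], because [G] divides [P]. *)
  rewrite -[S]/(gval (Group grS)) gen_subG; apply/subsetP=> _ /imsetP[j _ ->].
  rewrite col_circulant /= circ_colE 1?ltnW //; set w := _ %% _.
  have szw : (size w <= k)%N.
    by rewrite -ltnS -sizeP ltn_modp -size_poly_gt0 sizeP.
  have /dvdpP[q def_w] : G %| w.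
    by rewrite -(dvdp_mod _ (dvdp_gcdr A P)) dvdp_mull ?dvdp_gcdl.
  have szq : (size q <= r)%N.
    have [-> | q_neq0] := eqVneq q 0; first by rewrite size_poly0.
    move: szw; rewrite def_w size_mul // /r; move: G_neq0 q_neq0.
    rewrite -!size_poly_gt0; move: (size q) (size G) => s t; lia.
  by apply/imsetP; exists (poly_rV q); rewrite ?poly_rV_K -?def_w.
apply/subsetP=> _ /imsetP[b _ ->].
(* Bezout, valid up to the scalar [c], makes [rVpoly b * G] a multiple of [A] modulo [P]. *)
have [[u v] /=] := Bezoutp A P; rewrite eqp_sym => /eqpf_eq[c _ defG].
rewrite -[X in coef_col X]modp_Xn_sub_1_small ?size_mulG ?size_poly //.
have -> : rVpoly b * G = (c *: (rVpoly b * u)) * A + (c *: (rVpoly b * v)) * P.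
  by rewrite /G defG -!scalerAl -scalerDr -scalerAr mulrDr !mulrA.
by rewrite modpD modp_mull addr0 coef_col_mulr_circ.
Qed.

Lemma card_circ_group : #|N| = (p ^ (k - (size (gcdp A P)).-1))%N.
Proof.
rewrite circ_groupE card_imset; first by rewrite card_mx mul1n card_Fp.
move=> b c eq_bc; apply: (can_inj rVpolyK); apply: (mulIf G_neq0).
by apply: coef_col_inj eq_bc; rewrite size_mulG ?size_poly.
Qed.

End CirculantCard.

(** * Lifting polynomials over the prime field to polygons *)

Lemma Fp_root1_dvd_sum (k p : nat) (A : {poly 'F_p}) :
  prime p -> (size A <= k)%N -> root A 1 ->
  (p %| \sum_(i < k) nat_of_ord (A`_i)%R)%N.
Proof.
move=> p_pr szA; rewrite (dvdn_pcharf (pchar_Fp p_pr)) natr_sum /root.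
rewrite (horner_coef_wide _ szA) => /eqP eq0; apply/eqP; rewrite -[RHS]eq0.
by apply: eq_bigr => i _; rewrite expr1n mulr1 natr_Zp.
Qed.

Lemma Fp_oppK_nat (p : nat) (x : 'F_p) :
  prime p -> x != 0 -> (nat_of_ord (- x)%R + nat_of_ord x)%N = p.
Proof.
move=> p_pr nzx; have ltx := ltn_ord x.
have x_gt0 : (0 < x)%N.
  by rewrite lt0n; apply: contra nzx => /eqP x0; apply/eqP/val_inj.
rewrite /= modn_small; first by rewrite subnK ?Fp_cast // ltnW.
by rewrite ltn_subrL x_gt0.
Qed.

Lemma Fp_small_polygon (k p : nat) (A : {poly 'F_p}) :
  (3 <= k)%N -> prime p -> (size A <= k)%N ->
  (forall i, (i < k)%N -> A`_i != 0) -> root A 1 ->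
  (\sum_(i < k) (nat_of_ord (A`_i)%R) <= (k - 2) * p)%N ->
  exists2 a : k.-tuple nat, is_polygon p a &
    \poly_(i < k) (nth 0%N a i)%:R = A.
Proof.
move=> k_ge3 p_pr szA nzA rootA; set s := (\sum_(i < k) _)%N => le_s.
have p_gt1 := prime_gt1 p_pr.
have ltA i : (nat_of_ord (A`_i)%R < p)%N.
  by rewrite -[X in (_ < X)%N](Fp_cast p_pr) ltn_ord.
have pos_A i : (i < k)%N -> (0 < nat_of_ord (A`_i)%R)%N.
  by move=> /nzA; rewrite lt0n; apply: contra => /eqP Ai0; apply/eqP/val_inj.
have p_s : (p %| s)%N by exact: Fp_root1_dvd_sum.
set q := (s %/ p)%N; have def_s : s = (q * p)%N by rewrite divnK.
have le_q : (q <= k - 2)%N by rewrite -(leq_pmul2r (ltnW p_gt1)) -def_s.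
(* Adding [p] to [t] entries raises the sum from [q * p] to [(k - 2) * p]. Each entry stays strictly
   between 0 and [p] or moves strictly between [p] and [2 * p], so none equals [p]. *)
pose t := (k - 2 - q)%N.
pose a := [tuple (nat_of_ord (A`_i)%R + p * (i < t))%N | i < k].
have aE i (lt_ik : (i < k)%N) :
    nth 0%N a i = (nat_of_ord (A`_i)%R + p * (i < t))%N.
  by rewrite -(tnth_nth 0%N a (Ordinal lt_ik)) tnth_mktuple.
have Fp_p : p%:R = 0 :> 'F_p.
  by apply/eqP; rewrite -(dvdn_pcharf (pchar_Fp p_pr)).
exists a; last first.
  apply/polyP=> i; rewrite coef_poly; case: ltnP => [lt_ik | le_ki].
    by rewrite aE // natrD natrM Fp_p mul0r addr0 natr_Zp.
  by rewrite nth_default // (leq_trans szA).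
split=> //.
- move=> i; rewrite tnth_mktuple; have := ltA i; have := pos_A i (ltn_ord i).
  by case: (i < t)%N; rewrite ?muln1 ?muln0; split; lia.
- under eq_bigr do rewrite tnth_mktuple.
  rewrite big_split /= -/s -big_distrr /= def_s mulnC -mulnDr mulnC.
  congr (_ * _)%N.
  rewrite -big_mkcond /= sum1_card.
  have le_tk : (t <= k)%N by rewrite /t; lia.
  have -> : #|[pred i : 'I_k | (i < t)%N]| = t.
    rewrite -sum1_card -(big_ord_widen _ (fun=> 1%N) le_tk).
    by rewrite sum_nat_const card_ord muln1.
  by rewrite /t subnKC.
have k_gt0 : (0 < k)%N by apply: leq_trans k_ge3.
(* As [p] is prime, a nontrivial gcd would force [p] to divide the first entry, which is congruent
   to the nonzero constant coefficient of [A]. *)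
apply/eqP; rewrite gcdnC -/(coprime _ _) prime_coprime //.
apply/negP => p_dv.
have /(dvdn_trans p_dv) :
    (\big[gcdn/0]_(i < k) tnth a i %| tnth a (Ordinal k_gt0))%N.
  by rewrite (bigD1 (Ordinal k_gt0)) //= dvdn_gcdl.
rewrite tnth_mktuple dvdn_addl ?dvdn_mulr // => /dvdn_leq.
by rewrite pos_A // leqNgt ltA => /(_ isT).
Qed.

(** If the residues of [A] sum to more than [(k - 2) * p], those of [- A] sum to a multiple of [p]
    below [2 * p], hence to at most [p], and [k >= 3] leaves room for it. The sign is absorbed by
    [%=], which does not affect gcds up to a scalar. *)
Lemma Fp_polygon (k p : nat) (A : {poly 'F_p}) :
  (3 <= k)%N -> prime p -> (size A <= k)%N ->
  (forall i, (i < k)%N -> A`_i != 0) -> root A 1 ->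
  exists2 a : k.-tuple nat, is_polygon p a &
    \poly_(i < k) (nth 0%N a i)%:R %= A.
Proof.
move=> k_ge3 p_pr szA nzA rootA.
have [le_s | lt_s] :=
    leqP (\sum_(i < k) nat_of_ord (A`_i)%R)%N ((k - 2) * p)%N.
  have [a pol_a eqA] := Fp_small_polygon k_ge3 p_pr szA nzA rootA le_s.
  by exists a; last by rewrite eqA eqpxx.
have nzNA i : (i < k)%N -> (- A)`_i != 0.
  by move=> lt_ik; rewrite coefN oppr_eq0 nzA.
have szNA : (size (- A)%R <= k)%N by rewrite size_polyN.
have rootNA : root (- A) 1 by rewrite rootN.
have le_s : (\sum_(i < k) nat_of_ord ((- A)`_i)%R <= (k - 2) * p)%N.
  have : (p %| \sum_(i < k) nat_of_ord ((- A)`_i)%R)%N.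
    exact: Fp_root1_dvd_sum.
  have : (\sum_(i < k) nat_of_ord ((- A)`_i)%R +
          \sum_(i < k) nat_of_ord (A`_i)%R = k * p)%N.
    rewrite -big_split /= -[k in RHS]card_ord -sum_nat_const.
    apply: eq_bigr => i _.
    by rewrite coefN Fp_oppK_nat // nzA.
  move=> sumD /dvdnP[q def_q]; move: sumD lt_s; rewrite def_q.
  move=> sumD lt_s; have lt_q2 : (q * p < 2 * p)%N.
    by move: sumD lt_s; rewrite mulnBl; lia.
  by rewrite leq_mul2r; move: lt_q2; rewrite ltn_mul2r; lia.
have [a pol_a eqA] := Fp_small_polygon k_ge3 p_pr szNA nzNA rootNA le_s.
by exists a; last by rewrite eqA -scaleN1r eqp_scale ?oppr_eq0 ?oner_eq0.
Qed.

(** * Multiples of a factor of ['X^k - 1] with no zero coefficient *)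

Definition full_support (F : fieldType) (k : nat) (u : {poly F}) : Prop :=
  forall i, (i < k)%N -> u`_i != 0.

Lemma exists_comb_full_support (F : finFieldType) (u v : {poly F}) (n : nat) :
  (n.+1 < #|F|)%N -> (forall i, (i < n)%N -> (u`_i != 0) || (v`_i != 0)) ->
  exists2 c, c != 0 & full_support n (u + c *: v).
Proof.
(* Each index excludes at most one scalar, and 0 is excluded as well. Where [v] vanishes the
   quotient is 0 by convention, so nothing new is excluded. *)
move=> ltnF nz_uv; pose bad := 0 :: [seq - u`_i / v`_i | i <- iota 0 n].
have /subsetPn[c _ bad'c] : ~~ (F \subset bad).
  apply: contraL ltnF => /subset_leq_card le_F; rewrite -leqNgt.
  apply: leq_trans le_F _; apply: leq_trans (card_size _) _.
  by rewrite /= size_map size_iota.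
move: bad'c; rewrite inE negb_or => /andP[nz_c bad'c]; exists c => // i lt_in.
rewrite coefD coefZ; have [vi0 | nz_vi] := eqVneq v`_i 0.
  by have := nz_uv i lt_in; rewrite vi0 mulr0 addr0 eqxx orbF.
apply: contra bad'c; rewrite addrC addr_eq0 => /eqP def_cv.
apply/mapP; exists i; first by rewrite mem_iota.
by rewrite -def_cv mulfK.
Qed.

Section CyclicCode.

Variables (F : finFieldType) (k : nat).
Hypotheses (k_gt0 : (0 < k)%N) (ltkF : (k < #|F|)%N).
Let P : {poly F} := 'X^k - 1.

Lemma exists_full_support_dvdp (w : {poly F}) :
  w %| P -> (size w <= k)%N ->
  exists u : {poly F}, [/\ (size u <= k)%N, w %| u & full_support k u].
Proof.
move=> wP szw.
(* The value of [P] at 0 is -1, so no divisor of [P] vanishes there. Cyclic shifts then move this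
   nonzero coefficient to any position. *)
have nz_w0 : w`_0 != 0.
  apply: contraTneq wP => w0; apply/negP => /dvdpP[q].
  move/(congr1 (fun f : {poly F} => f.[0])).
  rewrite hornerM (horner_coef0 w) w0 mulr0 /P !hornerE expr0n gtn_eqF // sub0r.
  by move/eqP; rewrite oppr_eq0 oner_eq0.
have code_coef n : (n < k)%N ->
    exists v : {poly F}, [/\ (size v <= k)%N, w %| v & v`_n != 0].
  elim: n => [_ | n IHn lt_nk]; first by exists w.
  have [v [szv wv nz_vn]] := IHn (ltnW lt_nk).
  exists (cyc_shift k v).
  by rewrite size_cyc_shift // dvdp_cyc_shift // coef_cyc_shift // lt_nk.
(* The support is filled one position at a time; avoiding the bad scalars keeps the earlier
   coefficients nonzero. *)
suff prefix n : (n <= k)%N -> exists u : {poly F},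
    [/\ (size u <= k)%N, w %| u & full_support n u] by exact: prefix.
elim: n => [_ | n IHn lt_nk]; first by exists w.
have [u [szu wu nz_u]] := IHn (ltnW lt_nk).
have [un0 | nz_un] := eqVneq u`_n 0; last first.
  exists u; split=> // i; rewrite ltnS leq_eqVlt => /predU1P[-> // | ].
  exact: nz_u.
have [v [szv wv nz_vn]] := code_coef n lt_nk.
have [||c nz_c nz_uv] := @exists_comb_full_support F u v n.
- exact: leq_ltn_trans lt_nk ltkF.
- by move=> i /nz_u->.
exists (u + c *: v); split.
- rewrite (leq_trans (size_polyD _ _)) // geq_max szu.
  by rewrite (leq_trans (size_scale_leq _ _)).
- by rewrite dvdp_add // -mul_polyC dvdp_mull.
move=> i; rewrite ltnS leq_eqVlt => /predU1P[-> | /nz_uv //].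
by rewrite coefD coefZ un0 add0r mulf_neq0.
Qed.

Variables (l : nat) (g : 'I_l -> {poly F}).
Hypotheses (irr_g : forall i, irreducible_poly (g i)).
Hypothesis prod_g : P = \prod_(i < l) g i.
Hypothesis sepP : separable_poly P.

Definition prodg (S : {set 'I_l}) : {poly F} := \prod_(i in S) g i.
Definition degg (S : {set 'I_l}) : nat := (\sum_(i in S) (size (g i)).-1)%N.

(** Up to a scalar, this says that the gcd of [A] and [P] is [prodg (~: T)], in a form that is
    stable under the combinations below. *)
Definition exact_code (T : {set 'I_l}) (A : {poly F}) : Prop :=
  prodg (~: T) %| A /\ forall i, i \in T -> ~~ (g i %| A).

Let sizeP : size P = k.+1.
Proof. by rewrite size_XnsubC. Qed.

Lemma prodgC (S : {set 'I_l}) : prodg S * prodg (~: S) = P.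
Proof.
rewrite prod_g (bigID [in S]) /=; congr (_ * _).
by apply: eq_bigl => i; rewrite inE.
Qed.

Lemma size_prodg (S : {set 'I_l}) : size (prodg S) = (degg S).+1.
Proof.
rewrite /prodg size_prod => [|i _]; last exact: irredp_neq0.
suff -> : (\sum_(i in S) size (g i) = degg S + #|S|)%N.
  by rewrite -addSn; apply: addnK.
rewrite -sum1_card -big_split /=; apply: eq_bigr => i _.
by rewrite addn1 prednK // size_poly_gt0 irredp_neq0.
Qed.

Lemma deggC (S : {set 'I_l}) : (degg S + degg (~: S) = k)%N.
Proof.
have := congr1 (fun f : {poly F} => size f) (prodgC S).
rewrite sizeP size_mul -?size_poly_gt0 ?size_prodg //= addnS.
by case.
Qed.

Lemma dvdp_prodg (S1 S2 : {set 'I_l}) : S1 \subset S2 -> prodg S1 %| prodg S2.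
Proof.
move=> sS12; rewrite {2}/prodg (big_setID S1) /= (setIidPr sS12).
exact: dvdp_mulr.
Qed.

Lemma dvdp_prodg1 (i : 'I_l) (S : {set 'I_l}) : i \in S -> g i %| prodg S.
Proof.
move=> Si; have := @dvdp_prodg [set i] S.
by rewrite /prodg big_set1 sub1set; apply.
Qed.

Lemma coprimep_prodg (S : {set 'I_l}) : coprimep (prodg S) (prodg (~: S)).
Proof. by move: sepP; rewrite -(prodgC S) separable_mul => /and3P[]. Qed.

Lemma ndvdp_g_prodg (i : 'I_l) (S : {set 'I_l}) :
  i \notin S -> ~~ (g i %| prodg S).
Proof.
move=> S'i; rewrite -irreducible_poly_coprime //.
apply: (@coprimep_dvdr _ (prodg (~: S))); first by rewrite dvdp_prodg1 // inE.
by rewrite coprimep_sym coprimep_prodg.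
Qed.

Lemma exact_code_prodg (T : {set 'I_l}) : exact_code T (prodg (~: T)).
Proof.
split=> [|i Ti]; first exact: dvdpp.
by apply: ndvdp_g_prodg; rewrite inE Ti.
Qed.

(** Factors indexed by [T1] divide [A2] and those indexed by [T2] divide [A1], so neither summand
    disturbs the nondivisibility of the other. *)
Lemma exact_codeU (T1 T2 : {set 'I_l}) (A1 A2 : {poly F}) (c : F) :
  [disjoint T1 & T2] -> c != 0 -> exact_code T1 A1 -> exact_code T2 A2 ->
  exact_code (T1 :|: T2) (A1 + c *: A2).
Proof.
move=> T12 nz_c [dv1 ndv1] [dv2 ndv2]; split.
  rewrite dvdp_add ?dvdpZr //.
    by apply: dvdp_trans dv1; rewrite dvdp_prodg // setCS subsetUl.
  by apply: dvdp_trans dv2; rewrite dvdp_prodg // setCS subsetUr.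
move=> i; rewrite inE => /orP[T1i | T2i].
  have dv : g i %| c *: A2.
    rewrite dvdpZr // (dvdp_trans _ dv2) // dvdp_prodg1 //.
    by rewrite inE (disjointFr T12).
  by rewrite dvdp_addl // ndv1.
have dv : g i %| A1.
  by rewrite (dvdp_trans _ dv1) // dvdp_prodg1 // inE (disjointFl T12).
by rewrite dvdp_addr // dvdpZr // ndv2.
Qed.

(** Cancelling [prodg (~: T)] leaves the gcd of a cofactor with [prodg T], which is trivial since no
    irreducible factor in [T] divides that cofactor. *)
Lemma exact_code_gcdp (T : {set 'I_l}) (A : {poly F}) :
  exact_code T A -> (size (gcdp A P)).-1 = degg (~: T).
Proof.
case=> /dvdpP[B ->] ndv; rewrite -(prodgC T).
have coB : coprimep B (prodg T).
  rewrite /prodg; apply: (big_ind (coprimep B)) => [|u v Bu Bv|i Ti].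
  - exact: coprimep1.
  - by rewrite coprimepMr Bu.
  rewrite coprimep_sym irreducible_poly_coprime //.
  by apply: contra (ndv i Ti) => /dvdp_mulr ->.
rewrite (eqp_size (gcdp_mul2r _ _ _)).
have /eqpf_eq[c nz_c ->] : gcdp B (prodg T) %= 1 by rewrite gcdp_eqp1.
by rewrite -scalerAl mul1r size_scale // size_prodg.
Qed.

Lemma degg_gt0 (S : {set 'I_l}) (i : 'I_l) : i \in S -> (0 < degg S)%N.
Proof.
move=> Si; rewrite /degg (bigD1 i) //= ltn_addr // -subn1 subn_gt0.
by case: (irr_g i).
Qed.

Lemma full_support_neq0 (u : {poly F}) : full_support k u -> u != 0.
Proof. by move=> /(_ 0%N k_gt0); apply: contraNneq => ->; rewrite coef0. Qed.

(** A full-support multiple of the other factors is automatically exact: if [g i] divided it too,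
    [P] would divide a nonzero polynomial of size at most [k]. *)
Lemma exists_exact_code1 (i : 'I_l) :
  exists w : {poly F},
    [/\ (size w <= k)%N, full_support k w & exact_code [set i] w].
Proof.
have i_i : i \in [set i] by rewrite inE.
have [||u [szu Wu nz_u]] := @exists_full_support_dvdp (prodg (~: [set i])).
- by rewrite -(prodgC [set i]) dvdp_mull.
- rewrite size_prodg; have := deggC [set i]; have := degg_gt0 i_i.
  by move: (degg [set i]) (degg [set~ i]) => s t; lia.
exists u; split=> //; split=> // j; rewrite inE => /eqP ->; apply/negP => gi_u.
have : P %| u.
  rewrite -(prodgC [set i]) Gauss_dvdp ?coprimep_prodg // Wu andbT.
  by rewrite /prodg big_set1.
by move/(dvdp_leq (full_support_neq0 nz_u)); rewrite sizeP leqNgt ltnS szu.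
Qed.

Lemma exists_exact_code (T : {set 'I_l}) :
  T != set0 -> (degg T = 2 -> k.+1 < #|F|)%N ->
  exists A : {poly F},
    [/\ (size A <= k)%N, full_support k A & exact_code T A].
Proof.
move=> /set0Pn[i0 Ti0] small_k.
have setD1U i : i \in T -> T = [set i] :|: T :\ i by move=> Ti; rewrite setD1K.
have disj i : [disjoint [set i] & T :\ i] by rewrite disjoints1 !inE eqxx.
have big_deg i : i \in T -> (2 <= degg (T :\ i))%N ->
    exists A : {poly F},
      [/\ (size A <= k)%N, full_support k A & exact_code T A].
  move=> Ti deg2; have [w [szw nz_w exw]] := exists_exact_code1 i.
  (* The degree is at most [k - 2], so the top coefficient of [w] is untouched and only [k.-1]
     positions constrain [c]. *)
  have szQ : (size (prodg (~: (T :\ i))) <= k.-1)%N.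
    by rewrite size_prodg; have := deggC (T :\ i); lia.
  have [||c nz_c nz_wQ] :=
      @exists_comb_full_support F w (prodg (~: (T :\ i))) k.-1.
  - by rewrite prednK.
  - by move=> j lt_j; rewrite nz_w // (leq_trans lt_j) ?leq_pred.
  exists (w + c *: prodg (~: (T :\ i))); split.
  - rewrite (leq_trans (size_polyD _ _)) // geq_max szw.
    by rewrite (leq_trans (size_scale_leq _ _)) // (leq_trans szQ) ?leq_pred.
  - move=> j lt_jk; have [/nz_wQ // | le_j] := ltnP j k.-1.
    rewrite coefD coefZ [X in _ * X]nth_default ?(leq_trans szQ) //.
    by rewrite mulr0 addr0 nz_w.
  have := exact_codeU (disj i) nz_c exw (exact_code_prodg (T :\ i)).
  by rewrite -(setD1U i Ti).
have [T'0 | [i1 T'i1]] := set_0Vmem (T :\ i0).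
  by rewrite (setD1U i0 Ti0) T'0 setU0; exact: exists_exact_code1.
have [deg2 | deg1] := leqP 2 (degg (T :\ i0)); first exact: big_deg deg2.
have Ti1 : i1 \in T by case/setD1P: T'i1.
have ne_i10 : i1 != i0 by case/setD1P: T'i1.
have [deg2 | deg1'] := leqP 2 (degg (T :\ i1)); first exact: big_deg deg2.
have deggD1 i (S : {set 'I_l}) : i \in S ->
    degg S = (degg [set i] + degg (S :\ i))%N.
  by move=> Si; rewrite /degg big_set1 (big_setD1 i).
have pos_i i : (0 < degg [set i])%N by apply: (@degg_gt0 _ i); rewrite inE.
(* Removing [i0] or [i1] now leaves degree at most 1, so [T] consists of two linear factors, and
   [small_k] supplies the extra scalar. *)
have T'E : T :\ i0 = [set i1].
  apply/eqP; rewrite -(setD1K T'i1) setUC; apply/eqP/setUidPr.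
  have [-> | [i2 T''i2]] := set_0Vmem (T :\ i0 :\ i1); first exact: sub0set.
  move: deg1; rewrite (deggD1 i1) //; have := degg_gt0 T''i2.
  by have := pos_i i1; lia.
have degT : degg T = 2%N.
  rewrite (deggD1 i0) // T'E.
  have := degg_gt0 T'i1; move: deg1; rewrite T'E => d1 d2.
  have : (degg [set i0] <= degg (T :\ i1))%N.
    by rewrite (deggD1 i0 (T :\ i1)) ?leq_addr // !inE eq_sym ne_i10.
  by have := pos_i i0; lia.
have [w0 [szw0 nz_w0 ex0]] := exists_exact_code1 i0.
have [w1 [szw1 nz_w1 ex1]] := exists_exact_code1 i1.
have [||c nz_c nz_w] := @exists_comb_full_support F w0 w1 k.
- exact: small_k.
- by move=> j /nz_w0->.
exists (w0 + c *: w1); split=> //.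
  rewrite (leq_trans (size_polyD _ _)) // geq_max szw0.
  by rewrite (leq_trans (size_scale_leq _ _)).
rewrite (setD1U i0 Ti0) T'E; apply: exact_codeU => //.
by rewrite disjoints1 inE eq_sym.
Qed.

End CyclicCode.

(** * The exceptional case of codimension two with [p = k + 1] *)

Lemma exists_codim2_code (k p : nat) :
  (3 <= k)%N -> prime p -> k.+1 = p ->
  exists A : {poly 'F_p}, [/\ (size A <= k)%N, full_support k A, root A 1
    & (size (gcdp A ('X^k - 1))).-1 = (k - 2)%N].
Proof.
move=> k_ge3 p_pr def_p.
have oddp : odd p.
  by case: (even_prime p_pr) => // p2; move: k_ge3; rewrite -ltnS def_p p2.
have def_k : k = (k./2 * 2)%N.
  rewrite muln2 -[LHS]odd_double_half.
  by move: oddp; rewrite -def_p /= => /negPf->.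
set h := k./2 in def_k.
have nz_nat n : (0 < n < p)%N -> n%:R != 0 :> 'F_p.
  case/andP=> n_gt0 lt_np; rewrite -(dvdn_pcharf (pchar_Fp p_pr)).
  by apply/negP => /(dvdn_leq n_gt0); rewrite leqNgt lt_np.
have nz2 : 2 != 0 :> 'F_p by apply: nz_nat; lia.
have nz3 : 3 != 0 :> 'F_p by apply: nz_nat; lia.
have nz4 : 4 != 0 :> 'F_p by rewrite (natrM _ 2 2) mulf_neq0.
(* This is Fermat's little theorem for 2, since [4 ^+ h] is [2 ^+ k] and [k = p - 1]. *)
have pow4 : 4 ^+ h = 1 :> 'F_p.
  have -> : 4 = 2 ^+ 2 :> 'F_p by rewrite expr2 -natrM.
  rewrite -exprM mulnC -def_k; apply: (mulfI nz2).
  rewrite -exprS mulr1.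
  have := expf_card (2 : 'F_p); rewrite (card_Fp p_pr) -[X in 2 ^+ X]def_p.
  exact.
(* [Q] is the geometric-sum cofactor of ['X^2 - 4] in the difference of the [h]-th powers of ['X^2]
   and 4. *)
pose R : {poly 'F_p} := \poly_(i < h) 4 ^+ (h.-1 - i).
pose Q := R \Po 'X^2.
have defP : 'X^k - 1 = ('X^2 - 4%:P) * Q.
  have -> : 1 = 4%:P ^+ h :> {poly 'F_p} by rewrite -rmorphXn /= pow4.
  rewrite {1}def_k mulnC exprM subrXX.
  congr (_ * _).
  rewrite /Q /R poly_def rmorph_sum (reindex_inj rev_ord_inj) /=.
  apply: eq_bigr => i _.
  rewrite -mul_polyC comp_polyM comp_polyC comp_Xn_poly mulrC -rmorphXn /=.
  by congr ((_ ^+ _)%:P * _ ^+ _); have := ltn_ord i; lia.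
have coefQ i : Q`_i =
    if odd i then 0 else if (i < k)%N then 4 ^+ (h.-1 - i./2) else 0.
  rewrite /Q coef_comp_poly_Xn // dvdn2 divn2.
  case: (odd i) (odd_double_half i) => //= def_i.
  by rewrite coef_poly; congr (if _ then _ else _); lia.
have szX4 : size ('X^2 - 4%:P : {poly 'F_p}) = 3 by rewrite size_XnsubC.
have szP : size ('X^k - 1 : {poly 'F_p}) = k.+1 by rewrite size_XnsubC //; lia.
have nzX4 : 'X^2 - 4%:P != 0 :> {poly 'F_p} by rewrite -size_poly_gt0 szX4.
have nzQ : Q != 0.
  by apply/eqP => Q0; move: szP; rewrite defP Q0 mulr0 size_poly0.
have szQ : size Q = k.-1.
  by have := szP; rewrite defP size_mul // szX4 !addSn add0n => -[<-].
(* At 1, and below also at -1, ['X^2 - 4] takes the value -3, which is nonzero because [p > 3]. *)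
have root_Q : root Q 1.
  have : root ('X^k - 1 : {poly 'F_p}) 1 by rewrite rootE !hornerE expr1n subrr.
  rewrite defP rootM => /orP[|//]; rewrite rootE !hornerE expr1n => /eqP eq0.
  by case/negP: nz3; rewrite -oppr_eq0 -eq0; apply/eqP; ring.
exists (('X + 1) * Q); split.
- by rewrite (leq_trans (size_polyMleq _ _)) // szQ size_XaddC; lia.
(* [Q] has nonzero coefficients exactly in the even degrees below [k]; multiplication by ['X + 1]
   copies each one into the next odd degree without overlap. *)
- move=> i lt_ik; rewrite mulrDl mul1r coefD coefXM !coefQ.
  case: i lt_ik => [|i] lt_ik /=; first by rewrite add0r lt_ik expf_neq0.
  rewrite lt_ik (ltnW lt_ik).
  by case: (odd i); rewrite /= ?add0r ?addr0 expf_neq0.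
- by rewrite rootM root_Q orbT.
rewrite defP (eqp_size (gcdp_mul2r _ _ _)).
have : coprimep ('X + 1) ('X^2 - 4%:P : {poly 'F_p}).
  have -> : 'X + 1 = 'X - (-1)%:P :> {poly 'F_p} by rewrite polyCN opprK.
  rewrite coprimep_sym coprimep_XsubC rootE !hornerE sqrrN expr1n.
  by apply: contra nz3 => /eqP eq0; rewrite -oppr_eq0 -eq0; apply/eqP; ring.
rewrite -gcdp_eqp1 => /eqpf_eq[c nz_c ->].
by rewrite -scalerAl mul1r size_scale // szQ -!subn1 -subnDA.
Qed.

(** * Assembly of the theorem *)

Lemma ord_increasing_inj (m l : nat) (f : 'I_m -> 'I_l) :
  (forall i j : 'I_m, (i < j)%N -> (f i < f j)%N) -> injective f.
Proof.
move=> incr i j eq_f; case: (ltngtP i j) => [/incr | /incr | /val_inj //].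
  by rewrite eq_f ltnn.
by rewrite eq_f ltnn.
Qed.

Theorem theorem4 (k p : nat) (hk : (3 <= k)%N) (hp : prime p)
    (hkp : (k < p)%N) (l : nat) (g : 'I_l -> {poly 'F_p})
    (hg : forall i : 'I_l, irreducible_poly (g i))
    (hprod : 'X^k - 1 = \prod_(i < l) g i)
    (m : nat) (hm0 : (0 < m)%N) (hml : (m < l)%N) (idx : 'I_m -> 'I_l)
    (hidx : forall j1 j2 : 'I_m, (j1 < j2)%N -> (idx j1 < idx j2)%N)
    (hX : exists j : 'I_m, g (idx j) = 'X - 1)
    (d : nat) (hd : d = (\sum_(j < m) (size (g (idx j))).-1)%N) :
  exists a : k.-tuple nat,
    is_polygon p a /\
    exists to : groupAction [set: 'Z_k] [set: 'rV['Z_p]_(k - d)],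
      [set: monodromy p a] \isog [set: sdprod_by to].
Proof.
have k_gt0 : (0 < k)%N by apply: leq_trans hk.
have ltkF : (k < #|'F_p|)%N by rewrite card_Fp.
have inj_idx := ord_increasing_inj hidx.
(* [T] collects the factors that must not divide [A]; it is nonempty because [m < l]. *)
pose T := ~: [set idx j | j : 'I_m].
have defTC : ~: T = [set idx j | j : 'I_m] by rewrite setCK.
have ntT : T != set0.
  by rewrite -card_gt0 cardsCs defTC card_imset // !card_ord subn_gt0.
have def_d : d = degg g (~: T).
  by rewrite hd /degg defTC big_imset //= => j1 j2 _ _; exact: inj_idx.
have sepP : separable_poly ('X^k - 1 : {poly 'F_p}).
  apply: separable_Xn_sub_1; rewrite -(dvdn_pcharf (pchar_Fp hp)).
  by apply/negP => /(dvdn_leq k_gt0); rewrite leqNgt hkp.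
have [A [szA nzA rootA gcdA]] : exists A : {poly 'F_p},
    [/\ (size A <= k)%N, full_support k A, root A 1
      & (size (gcdp A ('X^k - 1))).-1 = d].
  (* In the exceptional branch only the value [d = k - 2] is kept, and [T] itself is abandoned.
     Otherwise [degg g T = 2] forces [k.+1 < p]. *)
  have [/andP[/eqP degT /eqP def_p] | notT2] :=
      boolP ((degg g T == 2) && (k.+1 == p))%N.
    have -> : d = (k - 2)%N.
      by rewrite def_d -degT -(deggC k_gt0 hg hprod T) addKn.
    exact: exists_codim2_code.
  have [|A [szA nzA exA]] := exists_exact_code k_gt0 ltkF hg hprod sepP ntT.
    move=> degT; rewrite card_Fp // ltn_neqAle hkp andbT.
    by move: notT2; rewrite degT eqxx.
  exists A; split=> //; last by rewrite (exact_code_gcdp hg hprod exA) def_d.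
  (* The selected factor ['X - 1] divides [A], which gives the root at 1. *)
  have [j gj] := hX; rewrite -dvdp_XsubCl polyC1 -gj.
  by apply: dvdp_trans exA.1; rewrite dvdp_prodg1 // defTC imset_f.
have [a pol_a eqA] := Fp_polygon hk hp szA nzA rootA.
exists a; split=> //; apply: monodromy_isog => //; first exact: ltnW.
have := card_circ_group a k_gt0 hp.
by rewrite (eqp_size (eqp_gcdl _ eqA)) gcdA (pdiv_id hp).
Qed.
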